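(* Let $H=(V,E)$ be a hypergraph with a cut edge $e$ such that for some non-trivial connected component $H'$ of $H-e$ we have $|e\cap V(H')|=1$. Then $H$ has a cut vertex.
   Context: A hypergraph $H=(V,E)$ consists of a nonempty finite vertex set $V$, a finite edge set $E$, and an incidence function $\psi:E\to 2^V$; edges are identified with their vertex sets (parallel edges allowed). A hypergraph is trivial if it has exactly one vertex. Two distinct vertices are adjacent via $e$ if both lie in $e$; a walk is a sequence $v_0e_1v_1\dots e_kv_k$ with $v_{i-1},v_i$ adjacent via $e_i$. For an equivalence class $V'$ of ''joined by a walk'', the connected component is $(V',\{f\in E:\emptyset\ne f\subseteq V'\})$; $\omega(H)$ is the number of components. $H-e=(V,E\setminus\{e\})$; $e$ is a cut edge if $\omega(H-e)>\omega(H)$. For $|V|\ge2$ and $v\in V$, $H\backslash v$ has vertex set $V\setminus\{v\}$ and edges $f\setminus\{v\}$ for all $f\in E$ with $f\setminus\{v\}\neq\emptyset$; $v$ is a cut vertex if $\omega(H\backslash v)>\omega(H)$. *)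

(* Defs.v *)
From mathcomp Require Import all_boot.

Set Implicit Arguments.
Unset Strict Implicit.
Unset Printing Implicit Defensive.

(* The vertices and edges are sets in finite ambient types, so that edge and
   vertex deletion and passing to a component stay in [hypergraph T I]. Edges
   are named by elements of [I], so parallel edges (and empty ones) are
   allowed; the values of [inc] outside [edges] are irrelevant. *)
Record hypergraph (T I : finType) := Hypergraph {
  verts : {set T};
  edges : {set I};
  inc : I -> {set T};
  verts_neq0 : verts != set0;
  inc_sub : forall f, f \in edges -> inc f \subset verts
}.

Section Hypergraph.
Variables T I : finType.
Implicit Type H : hypergraph T I.

Definition trivial_hg H : bool := #|verts H| == 1.

Definition adj_via H (f : I) : rel T :=
  [rel x y | [&& f \in edges H, x != y, x \in inc H f & y \in inc H f]].

(* The walk x e_1 v_1 ... e_k v_k with v_k = y is represented by its initial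
   vertex x and the sequence p = [:: (e_1, v_1); ...; (e_k, v_k)]; k = 0 is
   allowed. *)
Fixpoint walk H (x : T) (p : seq (I * T)) (y : T) : bool :=
  if p is (f, z) :: p' then adj_via H f x z && walk H z p' y
  else (x \in verts H) && (x == y).

(* Boolean form of "there is a walk from x to y", see [joinedP]. *)
Definition joined H : rel T :=
  connect [rel x y | [exists f, adj_via H f x y]].

Lemma adj_via_verts H f x y : adj_via H f x y -> y \in verts H.
Proof. by case/and4P=> fE _ _; apply/subsetP/inc_sub. Qed.

Lemma joinedP H x y :
  x \in verts H -> reflect (exists p, walk H x p y) (joined H x y).
Proof.
move=> xV; apply: (iffP connectP) => [[q] | [p]].
- elim: q x xV => [|z q IHq] x xV /=; first by move=> _ ->; exists [::]; rewrite /= xV /=.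
  case/andP=> /existsP[f xfz] qP yE.
  have [p pP] := IHq z (adj_via_verts xfz) qP yE.
  by exists ((f, z) :: p); rewrite /= -/(adj_via H f x z) xfz.
- elim: p x xV => [|[f z] p IHp] x xV /=.
    by case/andP=> _ /eqP <-; exists [::].
  case/andP=> xfz /(IHp z (adj_via_verts xfz)) [q qP yE].
  by exists (z :: q) => //=; rewrite qP andbT; apply/existsP; exists f.
Qed.

Definition classes H : {set {set T}} :=
  equivalence_partition (joined H) (verts H).

Definition component H (H' : hypergraph T I) : Prop :=
  [/\ verts H' \in classes H,
      edges H' =
        [set f in edges H | (inc H f != set0) && (inc H f \subset verts H')]
    & {in edges H', inc H' =1 inc H}].

(* Components correspond bijectively to the equivalence classes. *)
Definition omega H : nat := #|classes H|.

Lemma edge_del_sub H (e f : I) :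
  f \in edges H :\ e -> inc H f \subset verts H.
Proof. by case/setD1P=> _; apply: inc_sub. Qed.

Definition edge_del H (e : I) : hypergraph T I :=
  Hypergraph (verts_neq0 H) (@edge_del_sub H e).

Definition cut_edge H (e : I) : Prop :=
  e \in edges H /\ omega H < omega (edge_del H e).

Lemma vert_del_neq0 H (v : T) : 1 < #|verts H| -> verts H :\ v != set0.
Proof.
by rewrite -card_gt0 (cardsD1 v (verts H)); case: (v \in _) => // /ltnW.
Qed.

Lemma vert_del_sub H (v : T) f :
  f \in [set g in edges H | inc H g :\ v != set0] ->
  inc H f :\ v \subset verts H :\ v.
Proof. by rewrite inE => /andP[fE _]; apply/setSD/inc_sub. Qed.

Definition vert_del H (v : T) (V_gt1 : 1 < #|verts H|) : hypergraph T I :=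
  Hypergraph (vert_del_neq0 v V_gt1) (@vert_del_sub H v).

Definition cut_vertex H (v : T) : Prop :=
  v \in verts H /\
  exists V_gt1 : 1 < #|verts H|, omega H < omega (vert_del v V_gt1).

End Hypergraph.

(* Main.v *)
(** Let [u] be the only vertex of [e] in the nontrivial component [H'] of
    [H - e]. As [e] is a cut edge, it also has a vertex [w] outside [H']; pick a
    vertex [x != u] of [H']. Then [x] and [w] are joined in [H] through [u],
    but not in [H \ u], where no edge links [H'] to the rest. Every component
    of [H] keeps a vertex in [H \ u], that of [u] because it contains [w]; so
    [H \ u] has more components than [H] and [u] is a cut vertex. *)
Require Import Defs.
From mathcomp Require Import all_boot.

Set Implicit Arguments.
Unset Strict Implicit.
Unset Printing Implicit Defensive.

(** As [R'] refines [R], every class of [R'] lies in one class of [R]. The resulting map of classes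
    is onto, since each class of [R] meets [D'], but not injective: the distinct classes of [x] and
    [w] have the same image. *)
Lemma card_equivalence_partition_lt (T : finType) (R R' : rel T)
    (D D' : {set T}) (x w : T) :
    reflexive R' -> symmetric R -> transitive R -> subrel R' R ->
    {in D, forall y, exists2 z, z \in D' & R y z} -> D' \subset D ->
    x \in D' -> w \in D' -> R x w -> ~~ R' x w ->
  #|equivalence_partition R D| < #|equivalence_partition R' D'|.
Proof.
move=> R'xx symR trR sR'R meetD' sD'D xD' wD' Rxw nR'xw.
pose cls y := [set z in D | R y z].
pose cls' y := [set z in D' | R' y z].
(* Taking a union avoids choosing a representative of [C]: all its terms coincide when [C] is a
   class of [R']. *)
pose phi (C : {set T}) := \bigcup_(y in C) cls y.
have clsE y z : R y z -> cls y = cls z.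
  move=> Ryz; apply/setP=> t; rewrite !inE; congr (_ && _).
  by apply/idP/idP; apply: trR => //; rewrite symR.
have phiE y : y \in D' -> phi (cls' y) = cls y.
  move=> yD'; apply/eqP; rewrite eqEsubset; apply/andP; split.
    by apply/bigcupsP=> z; rewrite inE => /andP[_ /sR'R/clsE->].
  by apply: bigcup_sup; rewrite inE yD' R'xx.
set P' := equivalence_partition R' D'.
have cls'P y : y \in D' -> cls' y \in P' by move=> yD'; apply: imset_f.
have neq_cls' : cls' x != cls' w.
  apply: contraNneq nR'xw => /setP/(_ w).
  by rewrite !inE wD' R'xx.
(* Strictness comes from discarding [cls' w]: [phi] still maps the remaining classes onto those of
   [R], with [cls' x] standing in for [cls' w]. *)
rewrite [ltnRHS](cardsD1 (cls' w)) cls'P //= add1n ltnS.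
apply: leq_trans (leq_imset_card phi _); apply: subset_leq_card.
apply/subsetP=> C /imsetP[y /meetD'[z zD' Ryz] ->{C}].
rewrite -/(cls y) (clsE _ _ Ryz).
have [eq_zw | neq_zw] := eqVneq (cls' z) (cls' w).
  apply/imsetP; exists (cls' x); first by rewrite !inE neq_cls' cls'P.
  by rewrite -(phiE z) // eq_zw !phiE // (clsE _ _ Rxw).
by apply/imsetP; exists (cls' z); rewrite ?phiE // !inE neq_zw cls'P.
Qed.

Section Joined.
Variables T I : finType.
Implicit Types H : hypergraph T I.

Lemma adj_via_sym H f : symmetric (adj_via H f).
Proof. by move=> x y; rewrite /adj_via /= eq_sym [(x \in _) && _]andbC. Qed.

Lemma joined_sym H : symmetric (joined H).
Proof.
by apply: sym_connect_sym => x y; apply: eq_existsb => f; apply: adj_via_sym.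
Qed.

Lemma joined_trans H : transitive (joined H).
Proof. exact: connect_trans. Qed.

Lemma adj_joined H f x y : adj_via H f x y -> joined H x y.
Proof. by move=> xy; apply: connect1; apply/existsP; exists f. Qed.

Lemma joined_sub H H' :
    (forall f x y, adj_via H f x y -> joined H' x y) ->
  subrel (joined H) (joined H').
Proof. by move=> sHH'; apply: connect_sub => x y /existsP[f /sHH']. Qed.

Lemma joined_edge_del H e : subrel (joined (edge_del H e)) (joined H).
Proof.
apply: joined_sub => f x y /and4P[/setD1P[_ fE] xy xf yf].
by apply: (@adj_joined _ f); apply/and4P.
Qed.

Lemma adj_via_edge_del H e f x y :
  f != e -> adj_via H f x y -> adj_via (edge_del H e) f x y.
Proof. by move=> fe; rewrite /adj_via /= in_setD1 fe. Qed.

Lemma adj_via_vert_del H v (V_gt1 : 1 < #|verts H|) f x y :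
  adj_via (vert_del v V_gt1) f x y ->
  [/\ adj_via H f x y, x != v & y != v].
Proof.
case/and4P=> /[!inE] /andP[fE _] xy /andP[xv xf] /andP[yv yf].
by split=> //; apply/and4P.
Qed.

Lemma joined_vert_del H v (V_gt1 : 1 < #|verts H|) :
  subrel (joined (vert_del v V_gt1)) (joined H).
Proof. by apply: joined_sub => f x y /adj_via_vert_del[/adj_joined]. Qed.

(** An edge with at most one vertex makes no two distinct vertices adjacent, so deleting it changes
    neither [joined] nor [omega]. *)
Lemma cut_edge_card_gt1 H e : cut_edge H e -> 1 < #|inc H e|.
Proof.
case=> _; apply: contraTltn => /card_le1_eqP e_le1; rewrite -leqNgt.
suff eqJ : joined (edge_del H e) =2 joined H.
  rewrite /omega /classes /equivalence_partition; apply: eq_leq.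
  congr #|pred_of_set _|; apply: eq_imset => x.
  by apply/setP=> y; rewrite !inE eqJ.
move=> x y; apply/idP/idP; first exact: joined_edge_del.
apply: joined_sub => {x y} f x y xfy; have [fe | fe] := eqVneq f e.
  by case/and4P: xfy; rewrite fe => _ /eqP xy xe ye; case: xy; apply: e_le1.
exact/adj_joined/(adj_via_edge_del fe xfy).
Qed.

Lemma class_joined H (C : {set T}) x y :
  C \in classes H -> x \in C -> y \in C -> joined H x y.
Proof.
case/imsetP=> r _ -> /[!inE] /andP[_ rx] /andP[_ ry].
by apply: joined_trans ry; rewrite joined_sym.
Qed.

Lemma class_adj H (C : {set T}) f x y :
  C \in classes H -> adj_via H f x y -> (x \in C) = (y \in C).
Proof.
case/imsetP=> r _ -> xfy; rewrite !inE.
have yfx : adj_via H f y x by rewrite adj_via_sym.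
rewrite (adj_via_verts xfy) (adj_via_verts yfx) /=.
by apply/idP/idP => /joined_trans; apply; apply: adj_joined; eassumption.
Qed.

Lemma class_sub H (C : {set T}) : C \in classes H -> C \subset verts H.
Proof. by case/imsetP=> r _ ->; apply/subsetP=> x /[!inE] /andP[]. Qed.

End Joined.

Theorem theorem3p27 (T I : finType) (H : hypergraph T I) (e : I) :
  cut_edge H e ->
  (exists H' : hypergraph T I,
     [/\ component (edge_del H e) H',
         ~~ trivial_hg H'
       & #|inc H e :&: verts H'| = 1]) ->
  exists v : T, cut_vertex H v.
Proof.
move=> cut_e [H' [[C_class _ _] ntH' /eqP/cards1P[u eCu]]].
set C := verts H' in C_class ntH' eCu; have eE := cut_e.1.
have /setIP[ue uC] : u \in inc H e :&: C by rewrite eCu set11.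
have [w we wu] : exists2 w, w \in inc H e & w != u.
  have := cut_edge_card_gt1 cut_e.
  by rewrite (cardsD1 u) ue ltnS => /card_gt0P[w /setD1P[]]; exists w.
have eC z : z \in inc H e -> z != u -> z \notin C.
  by move=> ze; apply: contra => zC; rewrite -in_set1 -eCu inE ze.
have [x xC xu] : exists2 x, x \in C & x != u.
  have : 0 < #|C :\ u|.
    by move: ntH'; rewrite /trivial_hg -/C (cardsD1 u) uC eqSS lt0n.
  by case/card_gt0P=> x /setD1P[]; exists x.
have sCV : C \subset verts H := class_sub C_class.
have seV : inc H e \subset verts H := inc_sub eE.
have uV := subsetP sCV _ uC; have wV := subsetP seV _ we.
have Juw : joined H u w.
  by apply: (@adj_joined _ _ _ e); rewrite /adj_via /= eE eq_sym wu ue.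
have V_gt1 : 1 < #|verts H| by apply/card_gt1P; exists w, u.
exists u; split=> //; exists V_gt1.
apply: (@card_equivalence_partition_lt _ _ _ _ _ x w).
- exact: connect0.
- exact: joined_sym.
- exact: joined_trans.
- exact: joined_vert_del.
(* A vertex other than [u] survives the deletion and represents its own class; for [u] itself, [w]
   takes over. *)
- move=> y yV; have [-> | yu] := eqVneq y u; first by exists w; rewrite // !inE wu.
  by exists y; rewrite ?inE ?yu //; apply: connect0.
- exact: subsetDl.
- by rewrite !inE xu (subsetP sCV).
- by rewrite !inE wu.
(* [x] reaches [u] already in [H - e], within the class [C]; the edge [e] then leads from [u] to
   [w]. *)
- apply: joined_trans Juw.
  exact/(@joined_edge_del _ _ _ e)/(class_joined C_class).
(* No adjacency of [H \ u] crosses the boundary of [C]: what is left of [e] lies outside [C], and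
   any other edge comes from an edge of [H - e], where [C] is a class. *)
have closedC :
    closed [rel y z | [exists f, adj_via (vert_del u V_gt1) f y z]] C.
  move=> y z /existsP[f /adj_via_vert_del[yfz yu zu]].
  have [fe | fe] := eqVneq f e.
    case/and4P: yfz; rewrite fe => _ _ ye ze.
    by rewrite (negPf (eC y _ _)) // (negPf (eC z _ _)).
  exact: (class_adj C_class (adj_via_edge_del fe yfz)).
(* If [x] and [w] were joined in [H \ u], closedness would carry membership in [C] from [x] to
   [w]. *)
apply: contraNN (eC w we wu) => /(closed_connect closedC) <-.
exact: xC.
Qed.
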